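(* Let $\Omega\subset\mathbb{R}^n$ be a domain (not necessarily bounded), let $F:\mathbb{R}\times(\mathbb{R}^n\setminus\{0\})\times S^{n\times n}\to\mathbb{R}$, and let $Lu:=F(u,\nabla u,D^2u)$. Let $R=\max_{x\in\overline{\Omega}}\operatorname{dist}(x,\Omega^c)$. Suppose $\phi(r)$ is an increasing radial function defined in $B_r$ for some $r>R$ with $\phi(0)=0$, and $\lambda\in\mathbb{R}$ is such that $$L\phi+\lambda\phi\le 0\quad\text{in } B_r\setminus\{0\}$$ in the viscosity sense. Then $\lambda_1(\Omega)\ge\lambda$.
   Context: $S^{n\times n}$ is the set of real symmetric $n\times n$ matrices; $B_r$ is the ball of radius $r$ centered at the origin of $\mathbb{R}^n$; a domain is a connected open set; $\Omega^c=\mathbb{R}^n\setminus\Omega$. A radial function is one for which $\phi(x)$ depends only on $|x|$, written $\phi(x)=\phi(|x|)$; it is increasing when it is an increasing function of $|x|$. Lower semicontinuous envelope of $F$: $F_*(s,q,Y)=\liminf_{(r,p,X)\to(s,q,Y)}F(r,p,X)$; it is used because $F$ may be undefined or discontinuous where the gradient variable vanishes. Viscosity inequality: for an open set $U\subset\mathbb{R}^n$, a lower semicontinuous function $u$ on $U$ satisfies $Lu+\lambda u\le 0$ in $U$ in the viscosity sense (is a viscosity supersolution) if for every $\psi\in C^2$ that touches $u$ at a point $x\in U$ strictly from below (that is, $\psi(x)=u(x)$ and $\psi<u$ at the other points near $x$), one has $F_*(\psi(x),\nabla\psi(x),D^2\psi(x))+\lambda\psi(x)\le 0$. Principal eigenvalue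 of $-L$: $$\lambda_1(\Omega)=\sup\{\lambda\in\mathbb{R}:\ \exists\, v\in C(\Omega)\text{ satisfying } v(x)>0\ \forall x\in\Omega\text{ and } Lv+\lambda v\le 0\},$$ where the last inequality holds in $\Omega$ in the viscosity sense.
   Formalization: The function φ is additionally assumed continuous on B_r∖{0}; with φ only lower semicontinuous, as the viscosity definition requires, the claim fails (φ may jump). ''Increasing'' is read as strictly increasing. *)

(* Defs.v *)
From mathcomp Require Import all_boot all_order all_algebra.
From mathcomp Require Import all_classical all_reals all_analysis.

Set Implicit Arguments.
Unset Strict Implicit.
Unset Printing Implicit Defensive.

Import Order.TTheory GRing.Theory Num.Theory.
Import numFieldNormedType.Exports.

Local Open Scope classical_set_scope.
Local Open Scope ring_scope.

(* The library norm on row vectors is the sup norm; it induces the same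
   topology, but balls and distances here are Euclidean. *)
Definition enorm (R : realType) (n : nat) (x : 'rV[R]_n) : R :=
  Num.sqrt (\sum_(i < n) x 0 i ^+ 2).

Definition eball (R : realType) (n : nat) (r : R) : set 'rV[R]_n :=
  [set x | enorm x < r].

(* Extended real, equal to +oo when A is empty. *)
Definition edist_set (R : realType) (n : nat) (x : 'rV[R]_n) (A : set 'rV[R]_n) :
    \bar R :=
  ereal_inf [set (enorm (x - y))%:E | y in A].

Definition inradius (R : realType) (n : nat) (Omega : set 'rV[R]_n) : \bar R :=
  ereal_sup [set edist_set x (~` Omega) | x in closure Omega].

Definition domain (R : realType) (n : nat) (Omega : set 'rV[R]_n) : Prop :=
  open Omega /\ connected Omega.

Definition radial_on (R : realType) (n : nat) (A : set 'rV[R]_n)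
    (phi : 'rV[R]_n -> R) : Prop :=
  forall x y, A x -> A y -> enorm x = enorm y -> phi x = phi y.

Definition radially_increasing_on (R : realType) (n : nat)
    (A : set 'rV[R]_n) (phi : 'rV[R]_n -> R) : Prop :=
  forall x y, A x -> A y -> enorm x < enorm y -> phi x < phi y.

Definition partial (R : realType) (n : nat) (i : 'I_n) (psi : 'rV[R]_n -> R) :
    'rV[R]_n -> R :=
  fun x => 'D_(delta_mx 0 i) psi x.

Definition grad (R : realType) (n : nat) (psi : 'rV[R]_n -> R)
    (x : 'rV[R]_n) : 'rV[R]_n :=
  \row_(i < n) partial i psi x.

Definition hess (R : realType) (n : nat) (psi : 'rV[R]_n -> R)
    (x : 'rV[R]_n) : 'M[R]_n :=
  \matrix_(i < n, j < n) partial i (partial j psi) x.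

Definition C1 (R : realType) (n : nat) (psi : 'rV[R]_n -> R) : Prop :=
  [/\ continuous psi,
      forall (i : 'I_n) x, derivable psi x (delta_mx 0 i) &
      forall i : 'I_n, continuous (partial i psi)].

Definition C2 (R : realType) (n : nat) (psi : 'rV[R]_n -> R) : Prop :=
  C1 psi /\ forall i : 'I_n, C1 (partial i psi).

(* F is total here, but only its values on the set F_dom, that is
   R x (R^n \ {0}) x S^(n x n), are ever used. *)
Definition F_dom (R : realType) (n : nat) : set (R * 'rV[R]_n * 'M[R]_n) :=
  [set z | z.1.2 != 0 /\ z.2^T = z.2].

(* F_*: the liminf is taken along F_dom and, as usual for the semicontinuous
   envelope, does not exclude the point (s, q, Y) itself when it lies in F_dom.
   It may be infinite. *)
Definition lsc_env (R : realType) (n : nat)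
    (F : R -> 'rV[R]_n -> 'M[R]_n -> R)
    (s : R) (q : 'rV[R]_n) (Y : 'M[R]_n) : \bar R :=
  limf_einf (fun z : R * 'rV[R]_n * 'M[R]_n => (F z.1.1 z.1.2 z.2)%:E)
            (within (@F_dom R n) (nbhs (s, q, Y))).

Definition lsc_on (R : realType) (n : nat) (U : set 'rV[R]_n)
    (u : 'rV[R]_n -> R) : Prop :=
  forall x, U x -> forall a, a < u x -> \forall y \near within U (nbhs x), a < u y.

Definition touches_strictly_below (R : realType) (n : nat)
    (psi u : 'rV[R]_n -> R) (x : 'rV[R]_n) : Prop :=
  psi x = u x /\ \forall y \near x, y != x -> psi y < u y.

(* L u + lambda u <= 0 in the open set U in the viscosity sense, where
   L u = F(u, grad u, D^2 u). *)
Definition viscosity_supersolution (R : realType) (n : nat)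
    (F : R -> 'rV[R]_n -> 'M[R]_n -> R) (lambda : R)
    (U : set 'rV[R]_n) (u : 'rV[R]_n -> R) : Prop :=
  lsc_on U u /\
  forall (psi : 'rV[R]_n -> R) (x : 'rV[R]_n),
    U x -> C2 psi -> touches_strictly_below psi u x ->
    (lsc_env F (psi x) (grad psi x) (hess psi x) + (lambda * psi x)%:E <= 0)%E.

Definition lambda1 (R : realType) (n : nat)
    (F : R -> 'rV[R]_n -> 'M[R]_n -> R) (Omega : set 'rV[R]_n) : \bar R :=
  ereal_sup [set lambda%:E | lambda in
    [set lambda : R | exists v : 'rV[R]_n -> R,
      [/\ {within Omega, continuous v},
          forall x, Omega x -> 0 < v x &
          viscosity_supersolution F lambda Omega v]]].

(* Main.v *)
Require Import Defs.
From mathcomp Require Import all_boot all_order all_algebra.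
From mathcomp Require Import all_classical all_reals all_analysis.
From mathcomp Require Import ring lra.

Import Order.TTheory GRing.Theory Num.Theory.
Import numFieldNormedType.Exports.

Set Implicit Arguments.
Unset Strict Implicit.
Unset Printing Implicit Defensive.

Local Open Scope classical_set_scope.
Local Open Scope ring_scope.

(** Let d(x) be the Euclidean distance from x to the complement of Omega. The
    competitor in the definition of the principal eigenvalue is v = phi(d),
    where phi is read as a function of the radius. It is positive and
    continuous on Omega because 0 < d < r there and d is 1-Lipschitz for the
    Euclidean norm. When Omega is empty there is nothing to check.

    If Omega has a point, its complement is closed and nonempty (otherwise the
    inradius would be infinite), so for x in Omega the distance d(x) is
    attained at some y outside Omega ([edist_set_attained]). As phi is radially
    increasing, v(z) <= phi(z - y) for z near x, with equality at z = x. Hence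
    a test function touching v strictly from below at x becomes, once
    translated by y, a test function touching phi strictly from below at the
    point x - y of the punctured ball. The operator does not depend on the
    space variable, so the inequality satisfied by phi at x - y is the one
    required of v at x ([grad_translate], [hess_translate]). *)

(** * The Euclidean norm *)

Lemma enorm_ge0 (R : realType) (n : nat) (x : 'rV[R]_n) : 0 <= enorm x.
Proof. exact: sqrtr_ge0. Qed.

Lemma sqr_enorm (R : realType) (n : nat) (x : 'rV[R]_n) :
  enorm x ^+ 2 = \sum_(i < n) x 0 i ^+ 2.
Proof. by rewrite sqr_sqrtr // sumr_ge0 // => i _; exact: sqr_ge0. Qed.

Lemma ler_coord_enorm (R : realType) (n : nat) (x : 'rV[R]_n) (i : 'I_n) :
  `|x 0 i| <= enorm x.
Proof.
rewrite -sqrtr_sqr ler_sqrt ?sumr_ge0 // => [|j _]; last exact: sqr_ge0.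
by rewrite (bigD1 i) //= lerDl sumr_ge0 // => j _; exact: sqr_ge0.
Qed.

Lemma ler_norm_enorm (R : realType) (n : nat) (x : 'rV[R]_n) :
  `|x| <= enorm x.
Proof.
rewrite /Num.norm /= mx_normrE; apply: bigmax_le => [|[i j] _] /=.
  exact: enorm_ge0.
by rewrite ord1; exact: ler_coord_enorm.
Qed.

Lemma enorm_eq0 (R : realType) (n : nat) (x : 'rV[R]_n) :
  (enorm x == 0) = (x == 0).
Proof.
apply/eqP/eqP => [x0|->].
  by apply/eqP; rewrite -normr_le0 -x0 ler_norm_enorm.
by rewrite /enorm big1 ?sqrtr0 // => i _; rewrite mxE expr0n.
Qed.

Lemma enorm0 (R : realType) (n : nat) : enorm (0 : 'rV[R]_n) = 0.
Proof. by apply/eqP; rewrite enorm_eq0. Qed.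

Lemma enormN (R : realType) (n : nat) (x : 'rV[R]_n) : enorm (- x) = enorm x.
Proof. by congr Num.sqrt; apply: eq_bigr => i _; rewrite mxE sqrrN. Qed.

Lemma enorm_scale_delta (R : realType) (n : nat) (i : 'I_n) (a : R) :
  enorm (a *: delta_mx 0 i : 'rV[R]_n) = `|a|.
Proof.
rewrite /enorm (bigD1 i) //= big1 => [|j ji]; rewrite !mxE ?eqxx.
  by rewrite mulr1 addr0 sqrtr_sqr.
by rewrite (negbTE ji) mulr0 expr0n.
Qed.

Lemma enorm_cauchy_schwarz (R : realType) (n : nat) (a b : 'rV[R]_n) :
  \sum_(i < n) a 0 i * b 0 i <= enorm a * enorm b.
Proof.
have [->|a0] := eqVneq a 0.
  rewrite big1 => [|i _]; last by rewrite mxE mul0r.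
  by rewrite mulr_ge0 ?enorm_ge0.
have [->|b0] := eqVneq b 0.
  rewrite big1 => [|i _]; last by rewrite mxE mulr0.
  by rewrite mulr_ge0 ?enorm_ge0.
have A0 : 0 < enorm a by rewrite lt_def enorm_eq0 a0 enorm_ge0.
have B0 : 0 < enorm b by rewrite lt_def enorm_eq0 b0 enorm_ge0.
have AB0 : 0 < enorm a * enorm b by exact: mulr_gt0.
rewrite -(ler_pM2l AB0) -subr_ge0.
(* the difference is half the squared norm of |b| a - |a| b *)
have : 0 <= \sum_(i < n) (enorm b * a 0 i - enorm a * b 0 i) ^+ 2.
  by apply: sumr_ge0 => i _; exact: sqr_ge0.
have -> : \sum_(i < n) (enorm b * a 0 i - enorm a * b 0 i) ^+ 2 =
    enorm b ^+ 2 * (\sum_(i < n) a 0 i ^+ 2)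
    + enorm a ^+ 2 * (\sum_(i < n) b 0 i ^+ 2)
    - 2 * (enorm a * enorm b * \sum_(i < n) a 0 i * b 0 i).
  rewrite !mulr_sumr -sumrN -!big_split /=.
  by apply: eq_bigr => i _; ring.
rewrite -!sqr_enorm; nra.
Qed.

Lemma ler_enormD (R : realType) (n : nat) (a b : 'rV[R]_n) :
  enorm (a + b) <= enorm a + enorm b.
Proof.
rewrite -(@ler_pXn2r _ 2) ?nnegrE ?addr_ge0 ?enorm_ge0 //.
have -> : enorm (a + b) ^+ 2 =
    enorm a ^+ 2 + enorm b ^+ 2 + 2 * \sum_(i < n) a 0 i * b 0 i.
  rewrite !sqr_enorm mulr_sumr -!big_split /=.
  by apply: eq_bigr => i _; rewrite mxE; ring.
have := enorm_cauchy_schwarz a b; nra.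
Qed.

Lemma enorm_continuous (R : realType) (n : nat) :
  continuous (@enorm R n : 'rV[R]_n -> R).
Proof.
have sqr_c (i : 'I_n) : continuous (fun z : 'rV[R]_n => z 0 i ^+ 2 : R).
  move=> z; apply: (@continuous_comp _ R _ (fun z : 'rV[R]_n => z 0 i)
    (fun t : R => t ^+ 2)).
    exact: coord_continuous.
  exact: exprn_continuous.
have sum_c : continuous (fun x : 'rV[R]_n => \sum_(i < n) x 0 i ^+ 2 : R).
  by apply: continuous_big => [|i _]; [exact: add_continuous|exact: sqr_c].
by move=> x; apply: continuous_comp; [exact: sum_c|exact: sqrt_continuous].
Qed.

Lemma open_eball (R : realType) (n : nat) (r : R) : open (@eball R n r).
Proof.
have -> : @eball R n r = @enorm R n @^-1` [set t | t < r] by [].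
by apply: open_comp => [x _|]; [exact: enorm_continuous|exact: open_lt].
Qed.

Lemma open_punctured_eball (R : realType) (n : nat) (r : R) :
  open (@eball R n r `\ 0).
Proof.
have -> : @eball R n r `\ 0 = @eball R n r `&` @enorm R n @^-1` [set t | 0 < t].
  apply/seteqP; split=> x [xr x0]; split => //=.
    by rewrite lt_def enorm_ge0 enorm_eq0 andbT; exact/eqP.
  by move=> x_eq0; move: x0; rewrite /= lt_def enorm_eq0 x_eq0 eqxx.
apply: openI; first exact: open_eball.
by apply: open_comp => [x _|]; [exact: enorm_continuous|exact: open_gt].
Qed.

(** * The distance to a closed set *)

Section distance.
Variables (R : realType) (n : nat) (A : set 'rV[R]_n).
Hypotheses (A_closed : closed A) (A_neq0 : A !=set0).

(** Minimizing over all of A amounts to minimizing over the points of A no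
    farther from x than a given one, which form a compact set. *)
Lemma edist_set_attained (x : 'rV[R]_n) :
  exists2 y, A y & edist_set x A = (enorm (x - y))%:E.
Proof.
have [y0 Ay0] := A_neq0.
pose f (y : 'rV[R]_n) := enorm (x - y).
have fc : continuous f.
  move=> y; apply: (@continuous_comp _ _ _ (fun y : 'rV[R]_n => x - y)).
    by apply: continuousB; [exact: cst_continuous|move=> ?; exact: cvg_id].
  exact: enorm_continuous.
pose K := A `&` [set y | f y <= f y0].
have K0 : K !=set0 by exists y0; split => /=.
have Kc : compact K.
  apply: bounded_closed_compact.
    exists (`|x| + f y0); split; first exact: num_real.
    move=> M xM y [_ /= fy]; apply: le_trans (ltW xM).
    have -> : y = x - (x - y) by rewrite opprB addrC subrK.
    apply: le_trans (ler_normB _ _) _.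
    by rewrite lerD2l (le_trans (ler_norm_enorm _)).
  apply: closedI => //.
  have -> : [set y | f y <= f y0] = f @^-1` [set t | t <= f y0] by [].
  by apply: closed_comp => [y _|]; [exact: fc|exact: closed_le].
have [y /set_mem[Ay fy0] ymin] := EVT_min_rV K0 Kc (continuous_subspaceT fc).
exists y => //; apply/eqP; rewrite eq_le; apply/andP; split.
  by apply: ereal_inf_lbound; exists y.
apply: le_ereal_inf_tmp => _ [z Az <-]; rewrite lee_fin.
have [fz|/ltW fz] := leP (f z) (f y0); first by apply: ymin; apply/mem_set.
exact: le_trans fy0 fz.
Qed.

(** The real-valued distance to A; it agrees with [edist_set] when A is
    nonempty, and has the default value 0 when A is empty. *)
Definition dist_set (x : 'rV[R]_n) : R := fine (edist_set x A).

Lemma edist_setE (x : 'rV[R]_n) : edist_set x A = (dist_set x)%:E.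
Proof. by rewrite /dist_set; have [y _ ->] := edist_set_attained x. Qed.

Lemma dist_set_attained (x : 'rV[R]_n) :
  exists2 y, A y & dist_set x = enorm (x - y).
Proof.
by have [y Ay e] := edist_set_attained x; exists y => //; rewrite /dist_set e.
Qed.

Lemma dist_set_le (x y : 'rV[R]_n) : A y -> dist_set x <= enorm (x - y).
Proof.
by move=> Ay; rewrite -lee_fin -edist_setE; apply: ereal_inf_lbound; exists y.
Qed.

Lemma dist_set_gt0 (x : 'rV[R]_n) : ~ A x -> 0 < dist_set x.
Proof.
move=> Ax; have [y Ay ->] := dist_set_attained x.
rewrite lt_def enorm_ge0 enorm_eq0 subr_eq0 andbT.
by apply/eqP => xy; apply: Ax; rewrite xy.
Qed.

Lemma dist_set_lipschitz (x y : 'rV[R]_n) :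
  dist_set x <= dist_set y + enorm (y - x).
Proof.
have [z Az ->] := dist_set_attained y.
apply: le_trans (dist_set_le x Az) _.
rewrite -(enormN (y - x)) opprB.
have := ler_enormD (x - y) (y - z); rewrite addrA subrK; lra.
Qed.

Lemma dist_set_continuous : continuous dist_set.
Proof.
move=> x; apply/(@cvgrPdist_le _ _ _ (nbhs x)) => e e0.
have c : enorm (y - x) @[y --> x] --> (0 : R).
  have <- : enorm (x - x) = 0 by rewrite subrr enorm0.
  apply: (@continuous_comp _ _ _ (fun y : 'rV[R]_n => y - x)).
    by apply: continuousB; [move=> ?; exact: cvg_id|exact: cst_continuous].
  exact: enorm_continuous.
move/cvgr_le : c => /(_ e e0); apply: filterS => y yx.
have := dist_set_lipschitz x y; have := dist_set_lipschitz y x.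
rewrite -(enormN (x - y)) opprB ler_norml => yx' xy'; apply/andP; split; lra.
Qed.

End distance.

Lemma edist_set_setC_lt (R : realType) (n : nat) (Omega : set 'rV[R]_n)
    (x : 'rV[R]_n) (r : R) :
  (inradius Omega < r%:E)%E -> Omega x -> (edist_set x (~` Omega) < r%:E)%E.
Proof.
move=> hr Ox; apply: le_lt_trans hr; apply: ereal_sup_ubound.
by exists x => //; exact: subset_closure.
Qed.

(** * Translation of test functions *)

Section translation.
Variables (R : realType) (n : nat).
Implicit Types (psi : 'rV[R]_n -> R) (x y : 'rV[R]_n).

(** The function psi(. + y), whose graph is that of psi moved by - y. *)
Definition translate y psi : 'rV[R]_n -> R := fun x => psi (x + y).

(** The difference quotients defining the directional derivatives of psi(. + y)
    at x are literally those of psi at x + y. *)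
Lemma translate_quotient y psi x v :
  (fun h : R =>
     h^-1 *: ((translate y psi \o shift x) (h *: v) - translate y psi x)) =
  (fun h : R => h^-1 *: ((psi \o shift (x + y)) (h *: v) - psi (x + y))).
Proof. by apply/funext => h; rewrite /translate /= addrA. Qed.

Lemma derivable_translate y psi x v :
  derivable psi (x + y) v -> derivable (translate y psi) x v.
Proof. by rewrite /derivable translate_quotient. Qed.

Lemma partial_translate i y psi :
  partial i (translate y psi) = translate y (partial i psi).
Proof.
by apply/funext => x; rewrite /partial {2}/translate /derive translate_quotient.
Qed.

Lemma grad_translate y psi x : grad (translate y psi) x = grad psi (x + y).
Proof. by apply/rowP => i; rewrite !mxE partial_translate. Qed.

Lemma hess_translate y psi x : hess (translate y psi) x = hess psi (x + y).
Proof. by apply/matrixP => i j; rewrite !mxE !partial_translate. Qed.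

Lemma addr_cvg y x : z + y @[z --> x] --> x + y.
Proof.
by apply: (@continuousD _ _ _ id (cst y)); [exact: cvg_id|exact: cst_continuous].
Qed.

Lemma continuous_translate y psi :
  continuous psi -> continuous (translate y psi).
Proof.
move=> c x; apply: (@continuous_comp _ _ _ (fun z : 'rV[R]_n => z + y)).
  exact: addr_cvg.
exact: c.
Qed.

Lemma C1_translate y psi : C1 psi -> C1 (translate y psi).
Proof.
move=> [c d p]; split; first exact: continuous_translate.
  by move=> i x; exact: derivable_translate.
by move=> i; rewrite partial_translate; exact: continuous_translate.
Qed.

Lemma C2_translate y psi : C2 psi -> C2 (translate y psi).
Proof.
move=> [c p]; split; first exact: C1_translate.
by move=> i; rewrite partial_translate; exact: C1_translate.
Qed.

End translation.

(** * Radial profiles *)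

Section radial.
Variables (R : realType) (n : nat) (r : R) (phi : 'rV[R]_n -> R).
Hypotheses (phi_radial : radial_on (eball r) phi)
  (phi_incr : radially_increasing_on (eball r) phi).

Lemma radial_le (x y : 'rV[R]_n) :
  eball r y -> enorm x <= enorm y -> phi x <= phi y.
Proof.
move=> yr xy; have xr : eball r x by exact: le_lt_trans xy yr.
move: xy; rewrite le_eqVlt => /predU1P[xy|xy].
  by rewrite (phi_radial xr yr xy).
exact/ltW/phi_incr.
Qed.

End radial.

(** * The lower bound on the principal eigenvalue *)

Theorem theorem2p3 (R : realType) (n : nat) (n_gt0 : (0 < n)%N)
  (Omega : set 'rV[R]_n) (hOmega : domain Omega)
  (F : R -> 'rV[R]_n -> 'M[R]_n -> R)
  (r : R) (hr : (inradius Omega < r%:E)%E)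
  (phi : 'rV[R]_n -> R)
  (phi_cont : {within eball r `\ 0, continuous phi})
  (phi_radial : radial_on (eball r) phi)
  (phi_incr : radially_increasing_on (eball r) phi)
  (phi0 : phi 0 = 0)
  (lambda : R)
  (hphi : viscosity_supersolution F lambda (eball r `\ 0) phi) :
  (lambda%:E <= lambda1 F Omega)%E.
Proof.
apply: ereal_sup_ubound; exists lambda => //=.
have [Oopen _] := hOmega.
pose d := dist_set (~` Omega).
(* evaluating phi along a fixed ray turns it into a function of the radius *)
pose ray (t : R) : 'rV[R]_n := t *: delta_mx 0 (Ordinal n_gt0).
have Cclosed : closed (~` Omega) by exact: open_closedC.
(* the distance to an empty complement would be infinite, hence not below r *)
have C0 x : Omega x -> ~` Omega !=set0.
  move=> Ox; apply/set0P/eqP => C_eq0.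
  have := edist_set_setC_lt hr Ox.
  by rewrite /edist_set C_eq0 image_set0 ereal_inf0.
have d_gt0 x : Omega x -> 0 < d x.
  by move=> Ox; apply: (dist_set_gt0 Cclosed (C0 x Ox)) => /(_ Ox).
have d_ltr x : Omega x -> d x < r.
  move=> Ox; rewrite -lte_fin -(edist_setE Cclosed (C0 x Ox)).
  exact: edist_set_setC_lt.
have enorm_ray x : Omega x -> enorm (ray (d x)) = d x.
  by move=> Ox; rewrite enorm_scale_delta gtr0_norm ?d_gt0.
have ray_ball x : Omega x -> (eball r `\ 0) (ray (d x)).
  move=> Ox; split; first by rewrite /eball /= enorm_ray ?d_ltr.
  by move/eqP; rewrite -enorm_eq0 enorm_ray // gt_eqF ?d_gt0.
pose v x := phi (ray (d x)).
have v_cont x : Omega x -> {for x, continuous v}.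
  move=> Ox; apply: (@continuous_comp _ _ _ (ray \o d) phi).
    apply: continuous_comp; last by apply: cvgZr_tmp; exact: cvg_id.
    exact: (dist_set_continuous Cclosed (C0 x Ox)).
  move: phi_cont.
  rewrite (continuous_open_subspace _ (@open_punctured_eball _ _ _)).
  by apply; apply/mem_set; exact: ray_ball.
(* v lies below the translate of phi by y, within the ball of radius r at y *)
have v_le x y : Omega x -> ~ Omega y -> enorm (x - y) < r -> v x <= phi (x - y).
  move=> Ox Oy xyr; apply: (radial_le phi_radial phi_incr) => //.
  rewrite enorm_ray //.
  exact: (dist_set_le Cclosed (C0 x Ox)).
exists v; split.
- by apply: continuous_in_subspaceT => x /set_mem; exact: v_cont.
- move=> x Ox; have [xr x0] := ray_ball x Ox.
  rewrite -phi0; apply: phi_incr => //.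
    by rewrite /eball /= enorm0; exact: lt_trans (d_gt0 _ Ox) (d_ltr _ Ox).
  by rewrite enorm0 enorm_ray ?d_gt0.
split.
  move=> x Ox a av; apply: cvg_within.
  by have /cvgr_gt := v_cont x Ox; exact.
move=> psi x Ox psiC2 [psix psilt].
have [y Oy dxy] := dist_set_attained Cclosed (C0 x Ox) x.
have xyr : enorm (x - y) < r by rewrite -dxy; exact: d_ltr.
have xy_ball : (eball r `\ 0) (x - y).
  split => //; move/eqP; rewrite -enorm_eq0 -dxy.
  by rewrite gt_eqF // d_gt0.
have xyK : x - y + y = x by rewrite subrK.
(* psi(. + y) is the test function for phi at x - y *)
have := hphi.2 (translate y psi) (x - y) xy_ball (C2_translate y psiC2).
rewrite grad_translate hess_translate {2 3}/translate xyK; apply.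
split.
  rewrite /translate xyK psix; apply: phi_radial.
  - exact: (ray_ball x Ox).1.
  - exact: xyr.
  by rewrite enorm_ray.
have tr : z + y @[z --> x - y] --> x by rewrite -{2}xyK; exact: addr_cvg.
have near_lt := tr _ psilt.
have near_O := tr _ (open_nbhs_nbhs (conj Oopen Ox)).
have near_ball : \forall z \near x - y, eball r z.
  by apply: open_nbhs_nbhs; split => //; exact: open_eball.
near=> z => zxy.
have Ozy : Omega (z + y) by near: z.
have zr : enorm z < r by near: z.
have := v_le _ _ Ozy Oy; rewrite addrK => /(_ zr); apply: lt_le_trans.
have : z + y != x -> psi (z + y) < v (z + y) by near: z.
by apply; rewrite -xyK (inj_eq (addIr _)).
Unshelve. all: by end_near.
Qed.
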